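(* Let $w,c,d,\mathit{ch}\ge 0$ be real numbers with $w\ge c$ and $\mathit{ch}>2w$. If $d>c+\mathit{ch}$, then Game 1 has a unique sequential equilibrium $((s_1,s_2),(\beta_1,\beta_2))$, where $s_1$ plays $f(x)$ with probability $1$ (and $r$, $other$ with probability $0$) at $\mathcal I_1$; $s_2$ plays $f(x)$ with probability $1$ (and $r$, $other$ with probability $0$) at $\mathcal I_2$; $\beta_1$ assigns probability $1$ to $v_0$ at $\mathcal I_1$; and $\beta_2$ assigns probabilities $1,0,0$ to $v_1,v_2,v_3$ at $\mathcal I_2$.
   Context: Conventions. Games are finite two-player extensive-form games with imperfect information. A behavior strategy $s_i$ of player $i$ assigns to each information set of $i$ a probability distribution over the actions available there (independently across information sets); it is completely mixed if all actions get positive probability. A belief system $\beta$ assigns to each information set a probability distribution over its nodes. An assessment is a pair $(s,\beta)$ with $s=(s_1,s_2)$ a profile of behavior strategies. Player $i$'s expected payoff at a node $h$ is $u_i(s;h)=\sum_{\zeta}\Pr[\zeta\mid(s,h)]\,u_i(\zeta)$ (sum over terminal nodes $\zeta$), and at an information set $\mathcal I$ of player $i$ it is $u_i(s;\mathcal I,\beta)=\sum_{h\in\mathcal I}\beta(h)u_i(s;h)$. $(s,\beta)$ is sequentially rational if $u_i(s;\mathcal I,\beta)\ge u_i((s_i',s_{-i});\mathcal I,\beta)$ for every player $i$, every information set $\mathcal I$ of $i$ and every behavior strategy $s_i'$ of $i$. It is consistent if there are completely mixed profiles $s^k\to s$ such that the beliefs $\beta^k$ induced by $s^k$ via Bayes'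 rule converge to $\beta$. A sequential equilibrium is an assessment that is sequentially rational and consistent. The symbol $\mathit{ch}$ is a single real parameter; the action labels $f(x), r, other$ are formal symbols. Game 1. Players $C_1$ (utility $u_1$) and $C_2$ (utility $u_2$). At the root $v_0$, $C_1$ chooses $f(x)$ (to $v_1$), $r$ (to $v_2$) or $other$ (to $v_3$). Then $C_2$ moves, with actions $f(x),r,other$, leading, in this order, from $v_1$ to $v_4,v_5,v_6$; from $v_2$ to $v_7,v_8,v_9$; from $v_3$ to $v_{10},v_{11},v_{12}$ (terminal nodes). Information sets: $\mathcal I_1=\{v_0\}$ for $C_1$ and $\mathcal I_2=\{v_1,v_2,v_3\}$ for $C_2$. With $z=w-c+d-\mathit{ch}$, the payoffs $(u_1,u_2)$ are: $v_4:(w-c,w-c)$; $v_5,v_6:(z,-d)$; $v_7,v_{10}:(-d,z)$; $v_8:(w,w)$; $v_9,v_{11},v_{12}:(-d,-d)$. *)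

(* Defs.v *)
From HB Require Import structures.
From mathcomp Require Import all_boot all_order all_algebra.
From mathcomp Require Import boolp classical_sets reals topology normedtype.
From mathcomp Require Import sequences.

Set Implicit Arguments.
Unset Strict Implicit.
Unset Printing Implicit Defensive.

Import Order.TTheory GRing.Theory Num.Theory.
Import numFieldNormedType.Exports.

Local Open Scope ring_scope.

Section Distributions.
Variables (R : realType) (T : finType).

Definition is_distr (A : {set T}) (p : {ffun T -> R}) : bool :=
  [&& [forall t, 0 <= p t], [forall t, (t \notin A) ==> (p t == 0)]
    & \sum_(t in A) p t == 1].

Record distr (A : {set T}) := Distr {
  weight :> {ffun T -> R};
  _ : is_distr A weight }.

HB.instance Definition _ A := [isSub for @weight A].

End Distributions.

Variant player := C1 | C2.

Definition player_code (i : player) : bool := if i is C1 then true else false.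
Definition player_decode (b : bool) : player := if b then C1 else C2.
Lemma player_codeK : cancel player_code player_decode.
Proof. by case. Qed.
HB.instance Definition _ := Finite.copy player (can_type player_codeK).

(* [parent k = Some (h, a)] means that action [a] leads from [h] to [k].
   Injectivity of [parent] makes the initial node the only parentless one and
   makes each action at a node lead to one successor; together with
   [reachable] it makes the set of nodes a tree.  Games have no chance moves.
   [payoff] is only ever evaluated at terminal nodes. *)
Record game (R : realType) := Game {
  node : finType;
  action : finType;
  infoset : finType;
  initial : node;
  parent : node -> option (node * action);
  info : node -> option infoset;
  owner : infoset -> player;
  avail : infoset -> {set action};
  payoff : player -> node -> R;
  parent_inj : injective parent;
  parent_initial : parent initial = None;
  reachable : forall h, exists n,
    iter n (obind (fun k => omap fst (parent k))) (Some h) = Some initial;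
  info_None : forall h,
    info h = None <-> (forall k a, parent k <> Some (h, a));
  info_surj : forall I, exists h, info h = Some I;
  availP : forall h I a, info h = Some I ->
    (a \in avail I <-> exists k, parent k = Some (h, a)) }.

Section SequentialEquilibrium.
Variables (R : realType) (G : game R).

Definition terminal (h : node G) : bool := info h == None.

Definition members (I : infoset G) : {set node G} :=
  [set h | info h == Some I].

Definition infoset_of (i : player) := {I : infoset G | owner I == i}.

Definition strategy (i : player) :=
  forall I : infoset_of i, distr R (avail (val I)).

Definition profile := forall i, strategy i.

Definition belief := forall I : infoset G, distr R (members I).

Definition assessment := (profile * belief)%type.

Definition local (s : profile) (I : infoset G) : distr R (avail I) :=
  s (owner I) (exist _ I (eqxx (owner I))).

Definition move_prob (s : profile) (h : node G) (a : action G) : R :=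
  if info h is Some J then local s J a else 0.

(* Product of the move probabilities on the path from [h] to [k], and 0 if [k]
   is not a descendant of [h]; the path is followed upwards from [k], for at
   most [n] steps. *)
Fixpoint reach_prob_upto (n : nat) (s : profile) (h k : node G) : R :=
  if k == h then 1 else
  if n is m.+1 then
    if parent k is Some (p, a) then reach_prob_upto m s h p * move_prob s p a
    else 0
  else 0.

(* Every path in the tree has fewer than [#|node G|] edges. *)
Definition reach_prob (s : profile) (h k : node G) : R :=
  reach_prob_upto #|node G| s h k.

Definition node_payoff (i : player) (s : profile) (h : node G) : R :=
  \sum_(z | terminal z) reach_prob s h z * payoff i z.

Definition infoset_payoff (i : player) (s : profile) (I : infoset G)
    (beta : belief) : R :=
  \sum_(h in members I) beta I h * node_payoff i s h.

(* [dfwith s si'] is the profile (s_i', s_{-i}). *)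
Definition sequentially_rational (sb : assessment) : Prop :=
  forall (i : player) (I : infoset_of i) (si' : strategy i),
    infoset_payoff i (dfwith sb.1 si') (val I) sb.2
      <= infoset_payoff i sb.1 (val I) sb.2.

Definition completely_mixed (s : profile) : Prop :=
  forall (i : player) (I : infoset_of i) (a : action G),
    a \in avail (val I) -> 0 < s i I a.

Definition bayes (s : profile) (I : infoset G) (h : node G) : R :=
  reach_prob s (initial G) h
    / \sum_(k in members I) reach_prob s (initial G) k.

Local Open Scope classical_set_scope.

Definition consistent (sb : assessment) : Prop :=
  exists s_ : nat -> profile,
    [/\ forall k, completely_mixed (s_ k),
        forall (i : player) (I : infoset_of i) (a : action G),
          (fun k => s_ k i I a) @ \oo --> sb.1 i I a
      & forall (I : infoset G) (h : node G), h \in members I ->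
          (fun k => bayes (s_ k) I h) @ \oo --> sb.2 I h].

Definition sequential_equilibrium (sb : assessment) : Prop :=
  sequentially_rational sb /\ consistent sb.

End SequentialEquilibrium.

(* The action labels f(x), r and other. *)
Variant label1 := act_f | act_r | act_other.

Definition label1_code (a : label1) : 'I_3 :=
  match a with
  | act_f => @Ordinal 3 0 isT
  | act_r => @Ordinal 3 1 isT
  | act_other => @Ordinal 3 2 isT
  end.
Definition label1_decode (n : 'I_3) : label1 :=
  nth act_f [:: act_f; act_r; act_other] n.
Lemma label1_codeK : cancel label1_code label1_decode.
Proof. by case. Qed.
HB.instance Definition _ := Finite.copy label1 (can_type label1_codeK).

Variant node1 :=
  v0 | v1 | v2 | v3 | v4 | v5 | v6 | v7 | v8 | v9 | v10 | v11 | v12.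

Definition node1_seq :=
  [:: v0; v1; v2; v3; v4; v5; v6; v7; v8; v9; v10; v11; v12].
Definition node1_code (h : node1) : 'I_13 :=
  match h with
  | v0 => @Ordinal 13 0 isT | v1 => @Ordinal 13 1 isT
  | v2 => @Ordinal 13 2 isT | v3 => @Ordinal 13 3 isT
  | v4 => @Ordinal 13 4 isT | v5 => @Ordinal 13 5 isT
  | v6 => @Ordinal 13 6 isT | v7 => @Ordinal 13 7 isT
  | v8 => @Ordinal 13 8 isT | v9 => @Ordinal 13 9 isT
  | v10 => @Ordinal 13 10 isT | v11 => @Ordinal 13 11 isT
  | v12 => @Ordinal 13 12 isT
  end.
Definition node1_decode (n : 'I_13) : node1 := nth v0 node1_seq n.
Lemma node1_codeK : cancel node1_code node1_decode.
Proof. by case. Qed.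
HB.instance Definition _ := Finite.copy node1 (can_type node1_codeK).

Variant infoset1 := I1 | I2.

Definition infoset1_code (I : infoset1) : bool :=
  if I is I1 then true else false.
Definition infoset1_decode (b : bool) : infoset1 := if b then I1 else I2.
Lemma infoset1_codeK : cancel infoset1_code infoset1_decode.
Proof. by case. Qed.
HB.instance Definition _ := Finite.copy infoset1 (can_type infoset1_codeK).

Definition parent1 (h : node1) : option (node1 * label1) :=
  match h with
  | v0 => None
  | v1 => Some (v0, act_f) | v2 => Some (v0, act_r) | v3 => Some (v0, act_other)
  | v4 => Some (v1, act_f) | v5 => Some (v1, act_r) | v6 => Some (v1, act_other)
  | v7 => Some (v2, act_f) | v8 => Some (v2, act_r) | v9 => Some (v2, act_other)
  | v10 => Some (v3, act_f) | v11 => Some (v3, act_r)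
  | v12 => Some (v3, act_other)
  end.

Definition info1 (h : node1) : option infoset1 :=
  match h with
  | v0 => Some I1
  | v1 | v2 | v3 => Some I2
  | _ => None
  end.

Definition owner1 (I : infoset1) : player :=
  match I with I1 => C1 | I2 => C2 end.

Definition avail1 (I : infoset1) : {set label1} := [set: label1].

Section Game1.
Variables (R : realType) (w c d ch : R).

Definition payoffs1 (h : node1) : R * R :=
  let z := w - c + d - ch in
  match h with
  | v4 => (w - c, w - c)
  | v5 | v6 => (z, - d)
  | v7 | v10 => (- d, z)
  | v8 => (w, w)
  | v9 | v11 | v12 => (- d, - d)
  | v0 | v1 | v2 | v3 => (0, 0)
  end.

Definition payoff1 (i : player) (h : node1) : R :=
  match i with C1 => (payoffs1 h).1 | C2 => (payoffs1 h).2 end.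

Lemma parent1_inj : injective parent1.
Proof. by do 2![case]. Qed.

Lemma reachable1 h : exists n,
  iter n (obind (fun k : node1 => omap fst (parent1 k))) (Some h) = Some v0.
Proof.
by case: h; solve [exists 0%N => // | exists 1%N => // | exists 2%N => //].
Qed.

Lemma info1_None h : info1 h = None <-> (forall k a, parent1 k <> Some (h, a)).
Proof.
split=> [+ k a|]; first by case: h => // _; case: k.
by case: h => //= H; exfalso;
  solve [exact: (H v1 _ erefl) | exact: (H v4 _ erefl)
        | exact: (H v7 _ erefl) | exact: (H v10 _ erefl)].
Qed.

Lemma info1_surj I : exists h, info1 h = Some I.
Proof. by case: I; [exists v0 | exists v1]. Qed.

Lemma avail1P h I a : info1 h = Some I ->
  (a \in avail1 I <-> exists k, parent1 k = Some (h, a)).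
Proof.
move=> hI; rewrite /avail1 inE; split=> // _.
by move: hI; case: h => // _; case: a;
  [exists v1 | exists v2 | exists v3 | exists v4 | exists v5 | exists v6
  |exists v7 | exists v8 | exists v9 | exists v10 | exists v11 | exists v12].
Qed.

Definition game1 : game R :=
  {| initial := v0; owner := owner1; payoff := payoff1;
     parent_inj := parent1_inj; parent_initial := erefl;
     reachable := reachable1; info_None := info1_None;
     info_surj := info1_surj; availP := avail1P |}.

End Game1.

(* Main.v *)
(* Whatever C2 believes at I2, f(x) is strictly better for C2 than r and other,
   by at least d - c - ch > 0; against f(x), C1 gets w - c >= 0 from f(x) and
   -d < 0 from the other actions.  So rationality alone determines both
   strategies.  The three nodes of I2 are reached with total probability 1, so
   Bayes' rule gives them C1's action probabilities, which determines the
   limit beliefs. *)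
Require Import Defs.
From mathcomp Require Import all_boot all_order all_algebra reals.
From mathcomp Require Import boolp classical_sets topology normedtype sequences.
From mathcomp Require Import ring lra.

Set Implicit Arguments.
Unset Strict Implicit.
Unset Printing Implicit Defensive.

Import Order.TTheory GRing.Theory Num.Theory.
Import numFieldNormedType.Exports.

Local Open Scope ring_scope.

(** * Probability distributions on a finite set, and point masses *)

Section Distr.
Variables (R : realType) (T : finType) (A : {set T}).

Lemma distr_ge0 (p : distr R A) t : 0 <= p t.
Proof. by case: p => p /= /and3P[/forallP]. Qed.

Lemma distr_out (p : distr R A) t : t \notin A -> p t = 0.
Proof. by case: p => p /= /and3P[_ /forallP/(_ t)/implyP h _] /h/eqP. Qed.

Lemma distr_sum (p : distr R A) : \sum_(t in A) p t = 1.
Proof. by case: p => p /= /and3P[_ _ /eqP]. Qed.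

Lemma distr_ext (p q : distr R A) : (forall t, t \in A -> p t = q t) -> p = q.
Proof.
move=> pq; apply/val_inj/ffunP => t.
by have [/pq//|tA] := boolP (t \in A); rewrite !distr_out.
Qed.

Lemma distr_le1 (p : distr R A) t : p t <= 1.
Proof.
have [tA|/distr_out-> //] := boolP (t \in A).
rewrite -(distr_sum p) (bigD1 t) //= lerDl sumr_ge0 // => u _.
exact: distr_ge0.
Qed.

Lemma is_distr_dirac a : a \in A -> is_distr A [ffun t => (t == a)%:R : R].
Proof.
move=> aA; apply/and3P; split.
- by apply/forallP => t; rewrite ffunE ler0n.
- apply/forallP => t; apply/implyP => tA; rewrite ffunE.
  by have [ta|//] := eqVneq t a; rewrite ta aA in tA.
- rewrite (bigD1 a) //= ffunE eqxx big1 ?addr0 // => t /andP[_ /negbTE ta].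
  by rewrite ffunE ta.
Qed.

Definition dirac_distr a (aA : a \in A) : distr R A :=
  Distr (is_distr_dirac aA).

Lemma dirac_distrE a (aA : a \in A) t : dirac_distr aA t = (t == a)%:R.
Proof. by rewrite ffunE. Qed.

End Distr.

(** * Behavior profiles as families of local strategies *)

Section Games.
Variables (R : realType) (G : game R).

Lemma profile_ext (s t : profile G) :
  (forall I, local s I = local t I) -> s = t.
Proof.
move=> st; apply: functional_extensionality_dep => i.
apply: functional_extensionality_dep => -[I oI].
(* Replacing [i] by [owner I] turns [oI] into a proof of [owner I == owner I]; such proofs are all
   equal, so [eqxx], the one chosen in [local], may stand for it. *)
by case: _ / (eqP oI) (oI) => oI'; rewrite (eq_irrelevance oI' (eqxx _)) [LHS]st.
Qed.

Lemma local_dfwith_out (s : profile G) i (si' : strategy G i) I :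
  i != owner I -> local (dfwith s si') I = local s I.
Proof. by move=> iI; rewrite /local dfwith_out. Qed.

End Games.

(** * Explicit sums over the actions and nodes of Game 1 *)

Lemma sum_label1 (V : nmodType) (F : label1 -> V) :
  \sum_a F a = F act_f + F act_r + F act_other.
Proof.
rewrite (reindex label1_decode) /=; last first.
  exists label1_code => [i _|a _]; last exact: label1_codeK.
  by case: i => -[|[|[|]]] //= ?; apply: val_inj.
by rewrite !big_ord_recl big_ord0 addr0 addrA.
Qed.

Lemma node1_decodeK : cancel node1_decode node1_code.
Proof. by case; do 13?[case=> [?|]; first exact: val_inj]. Qed.

(** Turns the step bound of [reach_prob] into a numeral, so that reaching probabilities compute. *)
Lemma card_node1 : #|{: node1}| = 13.
Proof.
by rewrite (bij_eq_card (Bijective node1_codeK node1_decodeK)) card_ord.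
Qed.

Lemma sum_node1 (V : nmodType) (F : node1 -> V) :
  \sum_h F h = \sum_(h <- node1_seq) F h.
Proof.
rewrite (reindex node1_decode) /=; last first.
  by exists node1_code => h _; [exact: node1_decodeK | exact: node1_codeK].
by rewrite !big_ord_recl big_ord0 !big_cons big_nil.
Qed.

Section Game1.
Local Open Scope classical_set_scope.
Local Open Scope ring_scope.
Variables (R : realType) (w c d ch : R).
Local Notation G := (game1 w c d ch).

(** * Expected payoffs at the two information sets *)

Lemma sum_members_I1 (F : node G -> R) :
  \sum_(h in members (I1 : infoset G)) F h = F v0.
Proof.
rewrite big_mkcond sum_node1 !big_cons big_nil /= !inE /=.
by rewrite !addr0.
Qed.

Lemma sum_members_I2 (F : node G -> R) :
  \sum_(h in members (I2 : infoset G)) F h = F v1 + F v2 + F v3.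
Proof.
rewrite big_mkcond sum_node1 !big_cons big_nil /= !inE /=.
by rewrite !addr0 add0r !addrA.
Qed.

Lemma local_sum (s : profile G) I :
  local s I act_f + local s I act_r + local s I act_other = 1.
Proof.
rewrite -(distr_sum (local s I)) -sum_label1.
by apply: eq_bigl => a; rewrite inE.
Qed.

Lemma belief_I1 (b : belief G) : b I1 v0 = 1.
Proof. by rewrite -(distr_sum (b I1)) sum_members_I1. Qed.

Lemma belief_I2_sum (b : belief G) : b I2 v1 + b I2 v2 + b I2 v3 = 1.
Proof. by rewrite -(distr_sum (b I2)) sum_members_I2. Qed.

Lemma infoset_payoff_I1 (s : profile G) (b : belief G) :
  let p := local s I1 in let q := local s I2 in let z := w - c + d - ch in
  infoset_payoff C1 s I1 b =
    p act_f * (q act_f * (w - c) + (q act_r + q act_other) * z)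
    + p act_r * (q act_f * - d + q act_r * w + q act_other * - d)
    + p act_other * - d.
Proof.
move=> p q z.
rewrite /infoset_payoff sum_members_I1 belief_I1 mul1r /node_payoff big_mkcond.
rewrite sum_node1 !big_cons big_nil /reach_prob card_node1 /terminal /=.
rewrite /move_prob /= !mul1r -/p -/q -/z.
(* After [other], C1 gets [- d] whatever C2 does, so this term is spread over C2's actions by
   multiplying it by their total probability 1. *)
rewrite -[p act_other * - d]mulr1 -(local_sum s I2) -/q; ring.
Qed.

Lemma node_payoff_I2 i (s : profile G) :
  let q := local s I2 in
  [/\ node_payoff i s v1 =
        q act_f * payoff1 w c d ch i v4 + q act_r * payoff1 w c d ch i v5
        + q act_other * payoff1 w c d ch i v6,
      node_payoff i s v2 =
        q act_f * payoff1 w c d ch i v7 + q act_r * payoff1 w c d ch i v8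
        + q act_other * payoff1 w c d ch i v9
    & node_payoff i s v3 =
        q act_f * payoff1 w c d ch i v10 + q act_r * payoff1 w c d ch i v11
        + q act_other * payoff1 w c d ch i v12].
Proof.
by split; rewrite /node_payoff big_mkcond sum_node1 !big_cons big_nil
  /reach_prob card_node1 /terminal /= ?mul1r ?mul0r ?add0r ?addr0 ?addrA.
Qed.

Lemma infoset_payoff_I2 (s : profile G) (b : belief G) :
  let q := local s I2 in let z := w - c + d - ch in
  infoset_payoff C2 s I2 b =
    b I2 v1 * (q act_f * (w - c) + (q act_r + q act_other) * - d)
    + b I2 v2 * (q act_f * z + q act_r * w + q act_other * - d)
    + b I2 v3 * (q act_f * z + (q act_r + q act_other) * - d).
Proof.
move=> q z; rewrite /infoset_payoff sum_members_I2.
by have [-> -> ->] := node_payoff_I2 C2 s; rewrite /= !mulrDl !addrA.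
Qed.

(** * Bayes' rule, consistency and the candidate equilibrium *)

Lemma bayes_I1 (s : profile G) : bayes s I1 v0 = 1.
Proof.
rewrite /bayes sum_members_I1 /reach_prob card_node1 /=.
by rewrite divr1.
Qed.

(** The value [act_f] at the root is a dummy: only nodes of [I2] matter. *)
Definition action_to (h : node1) : label1 :=
  if parent1 h is Some (_, a) then a else act_f.

Lemma bayes_I2 (s : profile G) h :
  h \in members (I2 : infoset G) -> bayes s I2 h = local s I1 (action_to h).
Proof.
rewrite /bayes sum_members_I2 /reach_prob card_node1 /= /move_prob /= !mul1r.
by rewrite local_sum divr1 inE; case: h => //= _; rewrite mul1r.
Qed.

Lemma consistent_I2 (sb : assessment G) h : consistent sb ->
  h \in members (I2 : infoset G) -> sb.2 I2 h = local sb.1 I1 (action_to h).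
Proof.
case=> s_ [_ cs cb] hI; have := cb I2 h hI.
under eq_fun do rewrite bayes_I2 //.
(* C1's trembling probabilities converge both to the belief and to C1's limit strategy; real limits
   are unique. *)
move=> /cvg_unique; apply; first exact: norm_hausdorff.
exact: cs.
Qed.

(** One family gives both the equilibrium strategy, at [e = 0], and the completely mixed strategies
    approximating it, at small [e > 0]. *)
Definition tremble (e : R) : {ffun label1 -> R} :=
  [ffun a => if a == act_f then 1 - 2 * e else e].

Lemma is_distr_tremble e : 0 <= e -> 2 * e <= 1 ->
  is_distr [set: label1] (tremble e).
Proof.
move=> e0 e1; apply/and3P; split.
- by apply/forallP => a; rewrite ffunE; case: ifP; rewrite ?subr_ge0.
- by apply/forallP => a; rewrite inE.
- rewrite (eq_bigl xpredT) => [|a]; last by rewrite inE.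
  rewrite sum_label1 !ffunE /=; apply/eqP; ring.
Qed.

Definition tremble_profile e (e0 : 0 <= e) (e1 : 2 * e <= 1) : profile G :=
  fun i I => Distr (is_distr_tremble e0 e1).

Fact pure_profile_subproof : 2 * 0 <= 1 :> R.
Proof. by rewrite mulr0 ler01. Qed.

Definition pure_profile : profile G :=
  tremble_profile (lexx 0) pure_profile_subproof.

Lemma local_pure I a : local pure_profile I a = (a == act_f)%:R.
Proof. by rewrite ffunE mulr0 subr0; case: eqP. Qed.

(** The node reached in each information set when C1 plays f(x); the candidate belief is the point
    mass there. *)
Definition on_path (I : infoset1) : node1 := if I is I1 then v0 else v1.

Lemma on_path_mem (I : infoset G) : on_path I \in members I.
Proof. by rewrite inE; case: I. Qed.

Definition pure_assessment : assessment G :=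
  (pure_profile, fun I => dirac_distr R (on_path_mem I)).

Lemma consistent_pure : consistent pure_assessment.
Proof.
(* Since [harmonic k <= 1], dividing by 3 makes the two trembles sum to less than 1, which leaves
   f(x) positive probability. *)
have e0 k : 0 < harmonic k / 3 :> R by rewrite divr_gt0// harmonic_gt0.
have e1 k : 2 * (harmonic k / 3) < 1 :> R.
  have : harmonic k <= 1 :> R by rewrite invf_le1 ?ltr0n// ler1n.
  lra.
pose s_ k := tremble_profile (ltW (e0 k)) (ltW (e1 k)).
have cs i (I : infoset_of G i) a :
    (fun k => s_ k i I a) @ \oo --> (pure_profile I a).
  have ce : (fun k => harmonic k / 3 : R) @ \oo --> (0 : R).
    by rewrite -(mul0r 3^-1); apply: cvgMr_tmp; exact: cvg_harmonic.
  rewrite ffunE; under eq_fun do rewrite ffunE.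
  case: ifP => // _.
  by apply: cvgB; [exact: cvg_cst | apply: cvgMl_tmp].
exists s_; split=> //.
- by move=> k i I a _; rewrite ffunE; case: ifP; rewrite ?subr_gt0.
- case=> h hI.
  + move: (hI); rewrite inE; case: h {hI} => // _.
    under eq_fun do rewrite bayes_I1.
    by rewrite dirac_distrE; exact: cvg_cst.
  + under eq_fun do rewrite bayes_I2 //.
    (* By Bayes' rule, convergence of beliefs at [I2] is convergence of C1's strategies, already
       given by [cs]. *)
    have -> : pure_assessment.2 I2 h = local pure_profile I1 (action_to h).
      by rewrite dirac_distrE local_pure; move: hI; rewrite inE; case: h.
    exact: cs.
Qed.

(** * Best replies at the two information sets *)

Lemma local_f_other (s : profile G) I : local s I act_f = 1 ->
  local s I act_r = 0 /\ local s I act_other = 0.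
Proof.
move=> f1; have := local_sum s I; rewrite f1.
have := distr_ge0 (local s I) act_r; have := distr_ge0 (local s I) act_other.
by split; lra.
Qed.

(* [d - c - ch] is the smallest loss of C2, over the nodes of [I2], from
   playing another action than f(x). *)
Lemma infoset_payoff_I2_le (s : profile G) (b : belief G) :
  0 <= w -> 0 <= d -> 0 <= ch ->
  infoset_payoff C2 s I2 b <= b I2 v1 * (w - c)
    + (b I2 v2 + b I2 v3) * (w - c + d - ch)
    - (1 - local s I2 act_f) * (d - c - ch).
Proof.
move=> w0 d0 ch0.
have := distr_ge0 (b I2) v1; have := distr_ge0 (b I2) v2.
have := distr_ge0 (b I2) v3; have := belief_I2_sum b.
have := distr_ge0 (local s I2) act_r; have := distr_ge0 (local s I2) act_other.
have := local_sum s I2; rewrite infoset_payoff_I2.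
move: (local s I2 act_f) (local s I2 act_r) (local s I2 act_other)
  => f r o qs o0 r0.
move: (b I2 v1) (b I2 v2) (b I2 v3) => x1 x2 x3 xs x30 x20 x10.
rewrite -subr_ge0; set gap := (X in 0 <= X).
(* Each coefficient is the loss at one node in excess of [d - c - ch]. There is no [x2] next to [r]
   because playing r at [v2] loses exactly [d - c - ch]. *)
have -> : gap = r * (x1 * (w + ch) + x3 * (w + d))
              + o * (x1 * (w + ch) + (x2 + x3) * (w + d)).
  have fE : f = 1 - r - o by lra.
  have x1E : x1 = 1 - x2 - x3 by lra.
  by rewrite /gap fE x1E; ring.
by rewrite !(addr_ge0, mulr_ge0).
Qed.

Lemma infoset_payoff_I2_pure (s : profile G) (b : belief G) :
  local s I2 act_f = 1 ->
  infoset_payoff C2 s I2 b =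
    b I2 v1 * (w - c) + (b I2 v2 + b I2 v3) * (w - c + d - ch).
Proof.
move=> f1; have [r0 o0] := local_f_other f1.
rewrite infoset_payoff_I2 f1 r0 o0; ring.
Qed.

(** Against f(x), both other actions give C1 [- d], so all probability taken off f(x) costs the same
    rate [(w - c) + d]. *)
Lemma infoset_payoff_I1_pure (s : profile G) (b : belief G) :
  local s I2 act_f = 1 ->
  infoset_payoff C1 s I1 b = (w - c) - (1 - local s I1 act_f) * (w - c + d).
Proof.
move=> f1; have [r0 o0] := local_f_other f1.
rewrite infoset_payoff_I1 f1 r0 o0.
have -> : local s I1 act_f = 1 - local s I1 act_r - local s I1 act_other.
  by rewrite -(local_sum s I1); ring.
ring.
Qed.

Lemma local_dfwith_pure (s : profile G) i I : owner1 I = i ->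
  local (dfwith s (pure_profile (i:=i))) I act_f = 1.
Proof. by move=> <-; rewrite /local dfwith_in ffunE mulr0 subr0. Qed.

Lemma sequentially_rational_I2 (sb : assessment G) :
  0 <= w -> 0 <= d -> 0 <= ch -> c + ch < d ->
  sequentially_rational sb -> local sb.1 I2 act_f = 1.
Proof.
move=> w0 d0 ch0 dc.
move=> /(_ C2 (exist _ (I2 : infoset G) isT) (@pure_profile C2)) /=.
rewrite infoset_payoff_I2_pure ?local_dfwith_pure //.
(* The payoff of deviating to f(x) is the upper bound without its last term. Hence
   [(1 - f) * (d - c - ch) <= 0] for the probability [f] of f(x), and the second factor is
   positive. *)
move=> /le_trans/(_ (infoset_payoff_I2_le _ _ w0 d0 ch0)).
rewrite lerDl oppr_ge0 pmulr_lle0 => [f1|]; last by lra.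
by apply: le_anti; rewrite distr_le1 -subr_le0.
Qed.

Lemma sequentially_rational_I1 (sb : assessment G) :
  c <= w -> 0 < d -> local sb.1 I2 act_f = 1 ->
  sequentially_rational sb -> local sb.1 I1 act_f = 1.
Proof.
move=> cw d0 f1 /(_ C1 (exist _ (I1 : infoset G) isT) (@pure_profile C1)) /=.
rewrite !infoset_payoff_I1_pure //; last by rewrite local_dfwith_out.
rewrite local_dfwith_pure // subrr mul0r subr0 lerDl oppr_ge0
  pmulr_lle0 => [f2|]; last by lra.
by apply: le_anti; rewrite distr_le1 -subr_le0.
Qed.

Lemma sequentially_rational_pure :
  0 <= w -> 0 <= d -> 0 <= ch -> c <= w -> c + ch < d ->
  sequentially_rational pure_assessment.
Proof.
(* Only the pairs of a player and an information set that this player owns survive [//=]. *)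
move=> w0 d0 ch0 cw dc [] [[] //= oI] si'.
- rewrite !infoset_payoff_I1_pure ?local_pure //; last first.
    by rewrite local_dfwith_out // local_pure.
  have := distr_le1 (local (dfwith pure_profile si') I1) act_f.
  by rewrite subrr mul0r subr0 gerBl => p1; rewrite mulr_ge0; lra.
- rewrite [leRHS]infoset_payoff_I2_pure ?local_pure //.
  apply: le_trans (infoset_payoff_I2_le _ _ w0 d0 ch0) _.
  have := distr_le1 (local (dfwith pure_profile si') I2) act_f.
  by rewrite gerBl => p1; rewrite mulr_ge0; lra.
Qed.

(** * Uniqueness, and the theorem *)

Lemma sequential_equilibrium_unique (sb : assessment G) :
  0 <= w -> 0 < d -> 0 <= ch -> c <= w -> c + ch < d ->
  sequential_equilibrium sb -> pure_assessment = sb.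
Proof.
move=> w0 d_gt0 ch0 cw dc [sbr sbc].
have f2 := sequentially_rational_I2 w0 (ltW d_gt0) ch0 dc sbr.
have f1 := sequentially_rational_I1 cw d_gt0 f2 sbr.
have sE I : local sb.1 I = local pure_profile I.
  apply: distr_ext => a _.
  have fI : local sb.1 I act_f = 1 by case: I.
  have [rI oI] := local_f_other fI.
  by rewrite local_pure; case: a.
have /= sbE := profile_ext sE.
case: sb sbr sbc f2 f1 sE sbE => s b /= _ sbc _ _ _ sE; subst s.
congr (_, _); apply: functional_extensionality_dep => I.
apply: distr_ext => h hI; rewrite dirac_distrE.
(* With the strategies identified, the belief at the singleton [I1] is forced by normalization, and
   the one at [I2] by consistency. *)
case: I hI => hI.
- by move: (hI); rewrite inE; case: h {hI} => // _; rewrite belief_I1.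
- rewrite (consistent_I2 sbc hI) local_pure.
  by move: hI; rewrite inE; case: h.
Qed.

End Game1.

Theorem lemma5p1 (R : realType) (w c d ch : R) :
  0 <= w -> 0 <= c -> 0 <= d -> 0 <= ch ->
  c <= w -> 2 * w < ch -> c + ch < d ->
  exists sb : assessment (game1 w c d ch),
    [/\ unique (@sequential_equilibrium R (game1 w c d ch)) sb,
        [/\ local sb.1 I1 act_f = 1, local sb.1 I1 act_r = 0
          & local sb.1 I1 act_other = 0],
        [/\ local sb.1 I2 act_f = 1, local sb.1 I2 act_r = 0
          & local sb.1 I2 act_other = 0],
        sb.2 I1 v0 = 1
      & [/\ sb.2 I2 v1 = 1, sb.2 I2 v2 = 0 & sb.2 I2 v3 = 0]].
Proof.
move=> w0 c0 d0 ch0 cw chw dc; exists (pure_assessment w c d ch).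
split; rewrite ?local_pure ?dirac_distrE //.
(* What is left to [lra] is [0 < d], which follows from [c + ch < d] with [c] and [ch]
   nonnegative. *)
split=> [|sb]; last by apply: sequential_equilibrium_unique => //; lra.
by split; [exact: sequentially_rational_pure | exact: consistent_pure].
Qed.
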